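(* Let $S,\mathcal Z,h^{\mathcal Z},R$, $g_R=R^*h^{\mathcal Z}$, $g^S$, $\nabla^S$ and $G_R$ be as in the context, with $\dim S>0$. On the complete-response locus $S_{\mathrm{comp}}=\{p\in S:\ker R_p=\{0\}\}$ define the response volume density $d\operatorname{vol}_{g_R}=\sqrt{\det G_R}\;d\operatorname{vol}_{g^S}$. Then along every smooth path contained in $S_{\mathrm{comp}}$, $$\frac{D}{dt}d\operatorname{vol}_{g_R}=\frac12\operatorname{tr}\!\left(G_R^{-1}\frac{D}{dt}G_R\right)d\operatorname{vol}_{g_R},$$ where the derivative on densities is taken with respect to the connection induced by $\nabla^S$ and $\frac{D}{dt}G_R$ is the covariant derivative of $G_R$ along the path with respect to $\nabla^S$.
   Context: $S$ is a smooth finite-dimensional manifold parameterizing a smooth family $\{g_p\}_{p\in S}$ of normalized Einstein metrics on a fixed smooth manifold $M$. The family comes with the following given data, which is all that the statement uses: a smooth real vector bundle $\mathcal Z\to S$ of finite rank, a smooth positive-definite fibre metric $h^{\mathcal Z}$ on $\mathcal Z$, and a smooth vector bundle morphism $R:TS\to\mathcal Z$ over the identity of $S$. The response metric is $g_R(X,Y)=h^{\mathcal Z}(RX,RY)$. Fix an auxiliary Riemannian metric $g^S$ on $S$ with Levi-Civita connection $\nabla^S$ and Riemannian volume density $d\operatorname{vol}_{g^S}$. The response Gram operator $G_R$ is the smooth bundle endomorphism of $TS$ with $g^S(G_RX,Y)=g_R(X,Y)$; it is positive definite on $S_{\mathrm{comp}}$. *)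

(* Defs.v *)
From HB Require Import structures.
From mathcomp Require Import all_boot all_order all_algebra.
From mathcomp Require Import all_classical all_reals all_analysis.

Set Implicit Arguments.
Unset Strict Implicit.
Unset Printing Implicit Defensive.

Import Order.TTheory GRing.Theory Num.Theory.
Import numFieldNormedType.Exports.

Local Open Scope classical_set_scope.
Local Open Scope ring_scope.

Section SmoothMaps.
Variables (R : realType) (V W : normedModType R).

(* On an open subset A of a finite-dimensional V this is the class C^m. *)
Fixpoint Cm_on (m : nat) (A : set V) (f : V -> W) : Prop :=
  match m with
  | 0 => forall x, A x -> {for x, continuous f}
  | m'.+1 => (forall x, A x -> differentiable f x) /\
             (forall v, Cm_on m' A ('D_v f))
  end.

Definition smooth_on (A : set V) (f : V -> W) := forall m, Cm_on m A f.

End SmoothMaps.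

(* A chart is a pair phi, psi of mutually inverse homeomorphisms between
   dom i and the open set phi i @` dom i; both are total functions whose values
   elsewhere are irrelevant. The function pref chooses a chart around each
   point; it only serves to give the tangent spaces a concrete carrier. *)
Record smooth_manifold (R : realType) (n : nat) := SmoothManifold {
  carrier :> topologicalType;
  _ : hausdorff_space carrier;
  _ : @second_countable carrier;
  chart_index : Type;
  dom : chart_index -> set carrier;
  phi : chart_index -> carrier -> 'rV[R]_n;
  psi : chart_index -> 'rV[R]_n -> carrier;
  pref : carrier -> chart_index;
  dom_open : forall i, open (dom i);
  cod_open : forall i, open (phi i @` dom i);
  phiK : forall i p, dom i p -> psi i (phi i p) = p;
  phi_continuous : forall i p, dom i p -> {for p, continuous (phi i)};
  psi_continuous : forall i p, dom i p -> {for phi i p, continuous (psi i)};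
  dom_pref : forall p, dom (pref p) p;
  chart_compat : forall i j,
    smooth_on (phi i @` (dom i `&` dom j)) (phi j \o psi i)
}.

Section Calculus.
Variables (R : realType) (n : nat) (S : smooth_manifold R n).

(* Smoothness on an open subset U of S. *)
Definition smooth_map (W : normedModType R) (U : set S) (f : S -> W) :=
  forall i, smooth_on (phi i @` (U `&` dom i)) (f \o psi (s := S) i).

(* A tangent vector at p is represented by its components in the chart
   pref p. *)
Definition tangent (p : S) : lmodType R := 'rV[R]_n.

(* The components in the chart i of a tangent vector at p, and conversely the
   tangent vector at p with given components in the chart i (for p in dom i). *)
Definition tcoord (i : chart_index S) (p : S) (v : tangent p) : 'rV[R]_n :=
  'D_(v : 'rV[R]_n) (phi i \o psi (pref p)) (phi (pref p) p).

Definition tvec (i : chart_index S) (p : S) (w : 'rV[R]_n) : tangent p :=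
  'D_w (phi (pref p) \o psi i) (phi i p).

Definition vector_field := forall p : S, tangent p.

Definition smooth_field (U : set S) (X : vector_field) :=
  forall i, smooth_map (U `&` dom i) (fun p => tcoord i (X p)).

Definition differential (f : S -> R) (p : S) (v : tangent p) : R :=
  'D_(v : 'rV[R]_n) (f \o psi (pref p)) (phi (pref p) p).

End Calculus.

Arguments tangent {R n S} p : simpl never.

Record vector_bundle (R : realType) (n : nat) (S : smooth_manifold R n)
    (k : nat) := VectorBundle {
  fibre :> S -> lmodType R;
  triv_index : Type;
  triv_dom : triv_index -> set S;
  triv : forall (a : triv_index) (p : S), {linear fibre p -> 'rV[R]_k};
  triv_inv : forall (a : triv_index) (p : S), 'rV[R]_k -> fibre p;
  triv_open : forall a, open (triv_dom a);
  triv_cover : forall p, exists a, triv_dom a p;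
  trivK : forall a p, triv_dom a p -> cancel (triv a p) (triv_inv a p);
  triv_invK : forall a p, triv_dom a p -> cancel (triv_inv a p) (triv a p);
  triv_compat : forall a b w,
    smooth_map (triv_dom a `&` triv_dom b)
      (fun p => triv b p (triv_inv a p w))
}.

Section Metrics.
Variables (R : realType) (n : nat) (S : smooth_manifold R n).

Definition fibrewise_inner_product (E : S -> lmodType R)
    (g : forall p, E p -> E p -> R) :=
  [/\ (forall p a (x y z : E p),
         g p (a *: x + y) z = a * g p x z + g p y z),
      (forall p (x y : E p), g p x y = g p y x) &
      (forall p (x : E p), x != 0 -> 0 < g p x x)].

Definition riemannian_metric (g : forall p : S, tangent p -> tangent p -> R) :=
  fibrewise_inner_product g /\
  forall i v w, smooth_map (dom i) (fun p => g p (tvec i p v) (tvec i p w)).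

Variables (k : nat) (Z : vector_bundle S k).

Definition fibre_metric (h : forall p : S, Z p -> Z p -> R) :=
  fibrewise_inner_product h /\
  forall a v w,
    smooth_map (triv_dom a) (fun p => h p (triv_inv a p v) (triv_inv a p w)).

Definition smooth_section (U : set S) (s : forall p, Z p) :=
  forall a, smooth_map (U `&` triv_dom a) (fun p => triv a p (s p)).

(* Smoothness of morphisms TS -> Z and TS -> TS over the identity: they send
   coordinate vector fields to smooth sections. *)
Definition smooth_morphism (A : forall p : S, {linear tangent p -> Z p}) :=
  forall i v, smooth_section (dom i) (fun p => A p (tvec i p v)).

Definition smooth_endomorphism
    (A : forall p : S, {linear tangent p -> tangent p}) :=
  forall i v, smooth_field (dom i) (fun p => A p (tvec i p v)).

Definition response_metric (h : forall p : S, Z p -> Z p -> R)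
    (Rm : forall p : S, {linear tangent p -> Z p})
    (p : S) (X Y : tangent p) : R :=
  h p (Rm p X) (Rm p Y).

Definition complete_locus (Rm : forall p : S, {linear tangent p -> Z p}) :
    set S :=
  [set p | [set X | Rm p X = 0] = [set 0]].

End Metrics.

Section Connections.
Variables (R : realType) (n : nat) (S : smooth_manifold R n).

(* nabla Y p v is the covariant derivative of Y at p in the direction v; it is
   constrained only when Y is smooth near p. Local vector fields are covered,
   since a field on an open set may be extended arbitrarily. *)
Definition is_connection
    (nabla : vector_field S -> forall p : S, tangent p -> tangent p) :=
  [/\ (forall (U : set S) Y p a (v w : tangent p),
         open U -> U p -> smooth_field U Y ->
         nabla Y p (a *: v + w) = a *: nabla Y p v + nabla Y p w),
      (forall (U : set S) X Y p (v : tangent p),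
         open U -> U p -> smooth_field U X -> smooth_field U Y ->
         nabla (fun q => X q + Y q) p v = nabla X p v + nabla Y p v),
      (forall (U : set S) (f : S -> R) Y p (v : tangent p),
         open U -> U p -> smooth_map U f -> smooth_field U Y ->
         nabla (fun q => f q *: Y q) p v =
           differential f v *: Y p + f p *: nabla Y p v) &
      (forall (U : set S) X Y,
         open U -> smooth_field U X -> smooth_field U Y ->
         smooth_field U (fun p => nabla Y p (X p)))].

(* nabla_X Y - nabla_Y X = [X, Y], both sides being evaluated on functions. *)
Definition torsion_free
    (nabla : vector_field S -> forall p : S, tangent p -> tangent p) :=
  forall (U : set S) X Y (f : S -> R) p,
    open U -> U p -> smooth_field U X -> smooth_field U Y -> smooth_map U f ->
    differential f (nabla Y p (X p) - nabla X p (Y p)) =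
      differential (fun q => differential f (Y q)) (X p) -
      differential (fun q => differential f (X q)) (Y p).

Definition metric_compatible (g : forall p : S, tangent p -> tangent p -> R)
    (nabla : vector_field S -> forall p : S, tangent p -> tangent p) :=
  forall (U : set S) X Y p (v : tangent p),
    open U -> U p -> smooth_field U X -> smooth_field U Y ->
    differential (fun q => g q (X q) (Y q)) v =
      g p (nabla X p v) (Y p) + g p (X p) (nabla Y p v).

Definition levi_civita (g : forall p : S, tangent p -> tangent p -> R)
    (nabla : vector_field S -> forall p : S, tangent p -> tangent p) :=
  [/\ is_connection nabla, torsion_free nabla & metric_compatible g nabla].

End Connections.

Section LinearAlgebra.
Variables (R : realType) (n : nat) (S : smooth_manifold R n) (p : S).

Definition endo_mx (A : tangent p -> tangent p) : 'M[R]_n :=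
  lin1_mx (A : 'rV[R]_n -> 'rV[R]_n).

Definition endo_tr (A : tangent p -> tangent p) : R := \tr (endo_mx A).

Definition endo_det (A : tangent p -> tangent p) : R := \det (endo_mx A).

Definition endo_inv (A : tangent p -> tangent p) (x : tangent p) : tangent p :=
  (x : 'rV[R]_n) *m invmx (endo_mx A).

End LinearAlgebra.

Section Densities.
Variables (R : realType) (n : nat) (S : smooth_manifold R n).

(* A density at p is a function mu of n tangent vectors at p such that
   mu (B v_1) ... (B v_n) = |det B| * mu v_1 ... v_n; see is_density. *)
Definition multivector_fun (p : S) := ('I_n -> tangent p) -> R.

Definition is_density (p : S) (mu : multivector_fun p) :=
  forall (B : {linear tangent p -> tangent p}) (v : 'I_n -> tangent p),
    mu (fun i => B (v i)) = `|endo_det B| * mu v.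

Definition riemannian_volume (g : forall p : S, tangent p -> tangent p -> R)
    (p : S) : multivector_fun p :=
  fun v => Num.sqrt (\det (\matrix_(i, j) g p (v i) (v j))).

Definition response_volume (g : forall p : S, tangent p -> tangent p -> R)
    (G : forall p : S, {linear tangent p -> tangent p}) (p : S) :
    multivector_fun p :=
  fun v => Num.sqrt (endo_det (G p)) * riemannian_volume g v.

Lemma response_volume_density
    (g : forall p : S, tangent p -> tangent p -> R)
    (G : forall p : S, {linear tangent p -> tangent p}) (p : S) :
  fibrewise_inner_product g -> is_density (@response_volume g G p).
Proof.
case=> glin gsym _ B v.
pose gp : 'rV[R]_n -> 'rV[R]_n -> R := g p.
pose Q : 'M[R]_n := \matrix_(i, j) gp (delta_mx 0 i) (delta_mx 0 j).
have g0 z : gp 0 z = 0.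
  have := glin p 1 0 0 z; rewrite scale1r addr0 mul1r -/(gp 0 z) => /eqP.
  by rewrite -subr_eq0 opprD addrA subrr add0r oppr_eq0 => /eqP.
have gsuml (x z : 'rV[R]_n) : gp x z = \sum_i x 0 i * gp (delta_mx 0 i) z.
  rewrite {1}(row_sum_delta x); elim/big_rec2: _ => [|i a b _ <-] //.
  exact: glin.
have gE (x y : 'rV[R]_n) : gp x y = (x *m Q *m y^T) 0 0.
  rewrite gsuml -mulmxA mxE; apply: eq_bigr => i _; congr (_ * _).
  rewrite /gp gsym -/(gp _ _) gsuml mxE; apply: eq_bigr => j _.
  by rewrite !mxE mulrC /gp gsym.
have volE (w : 'I_n -> 'rV[R]_n) : riemannian_volume g (p := p) w =
    `|\det (\matrix_i w i)| * Num.sqrt (\det Q).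
  rewrite /riemannian_volume.
  suff -> : \matrix_(i, j) g p (w i) (w j) =
      (\matrix_i w i) *m Q *m (\matrix_i w i)^T.
    rewrite !det_mulmx det_tr mulrAC -expr2 sqrtrM ?sqr_ge0 //.
    by rewrite sqrtr_sqr.
  apply/matrixP => i j; rewrite mxE -/(gp _ _) gE.
  have rE k : w k = row k (\matrix_l w l) by rewrite rowK.
  rewrite [w i]rE [w j]rE tr_row -row_mul !mxE.
  by apply: eq_bigr => l _; rewrite !mxE.
rewrite /response_volume mulrCA; congr (_ * _).
rewrite (volE (fun i => B (v i))) (volE v) mulrA; congr (_ * _).
rewrite -normrM mulrC -det_mulmx; congr (`|\det _|).
apply/row_matrixP => i; rewrite row_mul !rowK /endo_mx.
pose B' : {linear 'rV[R]_n -> 'rV[R]_n} := B.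
by rewrite -[lin1_mx _]/(lin1_mx B') mul_rV_lin1.
Qed.

End Densities.

Section AlongPaths.
Variables (R : realType) (n : nat) (S : smooth_manifold R n).

(* Smoothness of gamma on J in the sense of extension: J may contain its
   endpoints, near which gamma is then given by a smooth extension. *)
Definition smooth_path (J : set R) (gamma : R -> S) :=
  forall t, J t -> exists O : set R,
    [/\ open O, O t, (forall s, O s -> {for s, continuous gamma}) &
        forall i, smooth_on (O `&` gamma @^-1` dom i) (phi i \o gamma)].

Definition velocity (gamma : R -> S) (t : R) : tangent (gamma t) :=
  derive1 (phi (pref (gamma t)) \o gamma) t.

Variable nabla : vector_field S -> forall p : S, tangent p -> tangent p.
Variable gamma : R -> S.

(* With V(s) = \sum_k V^k(s) d_k in the coordinates around gamma t, this is
     D/dt V = \sum_k ((V^k)'(t) d_k + V^k(t) nabla_{gamma'(t)} d_k). *)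
Definition Ddt_vector (V : forall s : R, tangent (gamma s)) (t : R) :
    tangent (gamma t) :=
  (derive1 (fun s => tcoord (pref (gamma t)) (V s)) t : tangent (gamma t)) +
  nabla (fun p => tvec (pref (gamma t)) p (V t)) (velocity gamma t).

(* The vector field along gamma with constant components in the chart
   pref (gamma t) and with value w at time t. *)
Definition extend (t : R) (w : tangent (gamma t)) (s : R) : tangent (gamma s) :=
  tvec (pref (gamma t)) (gamma s) w.

(* Induced connection on End(TS): (D/dt A) W = D/dt (A W) - A (D/dt W), where
   W is any vector field along gamma with W(t) = w. *)
Definition Ddt_endo (A : forall s : R, tangent (gamma s) -> tangent (gamma s))
    (t : R) (w : tangent (gamma t)) : tangent (gamma t) :=
  Ddt_vector (fun s => A s (extend w s)) t - A t (Ddt_vector (extend w) t).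

(* The density bundle is associated to the frame bundle by |det|^-1, so the
   induced connection is
     (D/dt mu)(E_1, ..., E_n) = d/dt mu(E_1, ..., E_n) - tr(omega) mu(E),
   where E is a frame along gamma and D/dt E_j = \sum_i omega_ij E_i. For a
   frame of constant components in the chart around gamma t, omega is the
   matrix of the endomorphism w |-> D/dt (extend w). *)
Definition Ddt_density (mu : forall s : R, multivector_fun (gamma s)) (t : R) :
    multivector_fun (gamma t) :=
  fun v => derive1 (fun s => mu s (fun k => extend (v k) s)) t -
           endo_tr (fun w => Ddt_vector (extend w) t) * mu t v.

End AlongPaths.

(* Main.v *)
(* In a chart around gamma t let A be the matrix of G, q the Gram matrix of the
   coordinate fields for gS, and C the connection matrix of the coordinate
   fields in the direction of the velocity. In the coordinate frame the density
   is a constant times sqrt (det A) * sqrt (det q). Jacobi's formula gives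
   (sqrt (det A))' = 1/2 tr (A' A^-1) sqrt (det A), and metric compatibility,
   q' = C q + q C^T, gives (sqrt (det q))' = tr C sqrt (det q); the correction
   term - tr C of the density connection cancels the latter. On the other side
   D/dt G has matrix A' + A C - C A, and tr ((A C - C A) A^-1) = 0. *)

Require Import Defs.
From HB Require Import structures.
From mathcomp Require Import all_boot all_order all_algebra.
From mathcomp Require Import all_classical all_reals all_analysis.
From mathcomp Require Import perm ring.

Set Implicit Arguments.
Unset Strict Implicit.
Unset Printing Implicit Defensive.

Import Order.TTheory GRing.Theory Num.Theory.
Import numFieldNormedType.Exports.

Local Open Scope classical_set_scope.
Local Open Scope ring_scope.

(** * Differentiability and the classes C^m on open sets *)

Lemma near_eq_differentiable (R : realType) (V W : normedModType R)
    (f g : V -> W) (a : V) :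
  (\near a, f a = g a) -> differentiable f a -> differentiable g a.
Proof.
move=> fg /diff_locallyP[df_cont fE].
(* [g] has at [a] the first-order expansion of [f], and such an expansion determines the
   differential. *)
have gE : g \o shift a = cst (g a) + 'd f a +o_ 0 id.
  apply/eqaddoP => e e0; move/eqaddoP : fE => /(_ e e0).
  have fg0 : \forall y \near (0 : V), f (y + a) = g (y + a).
    move: fg; rewrite (near_shift 0) /=.
    by apply: filterS => y /=; rewrite subr0.
  apply: filterS2 fg0 => y yE.
  by rewrite /= -!fctE /= !fctE /= yE (nbhs_singleton fg).
have dE := diff_unique df_cont gE.
by apply/diff_locallyP; rewrite dE.
Qed.

Section Cm.
Variables (R : realType) (V : normedModType R).

Lemma Cm_on_subset (W : normedModType R) m (A B : set V) (f : V -> W) :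
  A `<=` B -> Cm_on m B f -> Cm_on m A f.
Proof.
move=> AB; elim: m f => [|m IHm] f /= => [fB x /AB/fB//|[df Df]].
by split=> [x /AB/df//|v]; exact: IHm.
Qed.

Lemma Cm_onW (W : normedModType R) m (A : set V) (f : V -> W) :
  Cm_on m.+1 A f -> Cm_on m A f.
Proof.
elim: m f => [|m IHm] f [df Df].
  by move=> x Ax; exact/differentiable_continuous/df.
by split=> // v; exact: IHm.
Qed.

Lemma Cm_on_congr (W : normedModType R) m (A : set V) (f g : V -> W) :
  open A -> {in A, f =1 g} -> Cm_on m A f -> Cm_on m A g.
Proof.
move=> oA; elim: m f g => [|m IHm] f g fg.
  have fgx x : A x -> \near x, f x = g x.
    move=> Ax; have : nbhs x A by exact: open_nbhs_nbhs.
    by apply: filterS => y Ay; apply/fg/mem_set.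
  move=> fC x Ax; have fCx : f y @[y --> x] --> f x := fC x Ax.
  rewrite /prop_for /continuous_at -(fg x (mem_set Ax)).
  by apply: cvg_trans fCx; exact/near_eq_cvg/fgx.
have fgx x : A x -> \near x, f x = g x.
  move=> Ax; have : nbhs x A by exact: open_nbhs_nbhs.
  by apply: filterS => y Ay; apply/fg/mem_set.
case=> df Df; split=> [x Ax|v].
  exact: near_eq_differentiable (fgx _ Ax) (df _ Ax).
apply: IHm (Df v) => x /set_mem Ax; exact/near_eq_derive/fgx.
Qed.

Lemma Cm_on_cst (W : normedModType R) m (A : set V) (c : W) :
  Cm_on m A (fun=> c).
Proof.
elim: m c => [|m IHm] c; first by move=> x _; exact: cvg_cst.
split=> [x _|v]; first exact: differentiable_cst.
have -> : 'D_v (fun=> c) = (fun=> 0) :> (V -> W).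
  by apply/funext => x; exact: derive_cst.
exact: IHm.
Qed.

Lemma Cm_onD (W : normedModType R) m (A : set V) (f g : V -> W) :
  open A -> Cm_on m A f -> Cm_on m A g -> Cm_on m A (fun x => f x + g x).
Proof.
move=> oA; elim: m f g => [|m IHm] f g.
  by move=> fC gC x Ax; apply: cvgD; [exact: fC|exact: gC].
move=> [df Df] [dg Dg]; split=> [x Ax|v].
  by apply: differentiableD; [exact: df|exact: dg].
apply: Cm_on_congr (IHm _ _ (Df v) (Dg v)) => // x /set_mem Ax.
by rewrite -deriveD //; apply/diff_derivable; [exact: df|exact: dg].
Qed.

Lemma Cm_onM m (A : set V) (f g : V -> R) :
  open A -> Cm_on m A f -> Cm_on m A g -> Cm_on m A (fun x => f x * g x).
Proof.
move=> oA; elim: m f g => [|m IHm] f g.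
  by move=> fC gC x Ax; apply: cvgM; [exact: fC|exact: gC].
move=> fC gC; have [df Df] := fC; have [dg Dg] := gC.
split=> [x Ax|v].
  by apply: differentiableM; [exact: df|exact: dg].
(* Each term of the product rule keeps one factor undifferentiated; [Cm_onW] lowers that factor to
   the order of the induction hypothesis. *)
have fDg := IHm _ _ (Cm_onW fC) (Dg v); have gDf := IHm _ _ (Cm_onW gC) (Df v).
apply: Cm_on_congr (Cm_onD oA fDg gDf) => // x /set_mem Ax.
rewrite (@deriveM R V f g x v); last 2 first.
- exact/diff_derivable/df.
- exact/diff_derivable/dg.
by rewrite /GRing.scale /= [g x * _]mulrC.
Qed.

Lemma Cm_on_sum (W : normedModType R) m (A : set V) (I : Type)
    (r : seq I) (f : I -> V -> W) :
  open A -> (forall i, Cm_on m A (f i)) ->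
  Cm_on m A (fun x => \sum_(i <- r) f i x).
Proof.
move=> oA fC; elim: r => [|i r IHr].
  by under eq_fun do rewrite big_nil; exact: Cm_on_cst.
by under eq_fun do rewrite big_cons; exact: Cm_onD.
Qed.

(** Reduces row-valued maps to scalar ones, where the product lemma [Cm_onM] applies; the chain rule
    below uses both directions. *)
Lemma Cm_on_coordP m n (A : set V) (f : V -> 'rV[R]_n) : open A ->
  Cm_on m A f <-> forall k, Cm_on m A (fun x => f x 0 k).
Proof.
move=> oA; have Dcoord v (g : V -> 'rV[R]_n) k x : differentiable g x ->
    'D_v (fun y => g y 0 k) x = ('D_v g x) 0 k.
  by move=> dg; rewrite derive_mx ?mxE //; exact: diff_derivable.
elim: m f => [|m IHm] f; split.
- move=> fC k x Ax; apply: (@continuous_comp _ _ _ f (fun y => y 0 k)).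
    exact: fC.
  exact: coord_continuous.
- move=> fC; have -> : f = fun y => \sum_k f y 0 k *: delta_mx 0 k.
    by apply/funext => y; exact: row_sum_delta.
  apply: (@Cm_on_sum _ 0 A _ _ (fun k y => f y 0 k *: delta_mx 0 k)) => //.
  move=> k x Ax.
  exact: (cvgZr_tmp (fC k x Ax)).
- move=> [df Df] k; split=> [x Ax|v].
    apply: (@differentiable_comp _ _ _ _ f (fun y => y 0 k)); first exact: df.
    exact: differentiable_coord.
  move/IHm: (Df v) => /(_ k); apply: Cm_on_congr => // x /set_mem Ax.
  by rewrite Dcoord //; exact: df.
- move=> fC.
  have df x : A x -> differentiable f x.
    move=> Ax.
    have -> : f = \sum_k (fun y => f y 0 k *: delta_mx 0 k).
      by apply/funext => y; rewrite fct_sumE; exact: row_sum_delta.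
    apply: differentiable_sum => k; apply: differentiableZl.
    by have [+ _] := fC k; apply.
  split=> // v; apply/IHm => k.
  have [_ /(_ v)] := fC k; apply: Cm_on_congr => // x /set_mem Ax.
  by rewrite Dcoord //; exact: df.
Qed.

Lemma derive_comp_row n (W : normedModType R) (f : V -> 'rV[R]_n)
    (g : 'rV[R]_n -> W) (x v : V) :
  differentiable f x -> differentiable g (f x) ->
  'D_v (g \o f) x = 'D_('D_v f x) g (f x).
Proof.
move=> df dg; have dgf := differentiable_comp df dg.
by rewrite (deriveE _ dgf) (deriveE _ dg) (deriveE _ df) diff_comp.
Qed.

(** In ['D_('D_v f x) g (f x)] the direction varies with [x], whereas [Cm_on] speaks of fixed
    directions. Expanding the direction in the standard basis gives a sum of products of components
    of ['D_v f] with partial derivatives of [g] composed with [f], and the induction hypothesis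
    covers these. *)
Lemma Cm_on_comp m n l (A : set V) (B : set 'rV[R]_n) (f : V -> 'rV[R]_n)
    (g : 'rV[R]_n -> 'rV[R]_l) :
  open A -> open B -> (forall x, A x -> B (f x)) ->
  Cm_on m A f -> Cm_on m B g -> Cm_on m A (g \o f).
Proof.
move=> oA oB fAB; elim: m g => [|m IHm] g.
  by move=> fC gC x Ax; apply: continuous_comp; [exact: fC|exact/gC/fAB].
move=> fC gC; have [df Df] := fC; have [dg Dg] := gC.
split=> [x Ax|v].
  by apply: differentiable_comp; [exact: df|exact/dg/fAB].
apply/(Cm_on_coordP _ _ oA) => j.
have : Cm_on m A (fun x => \sum_k (('D_v f x) 0 k *
    ('D_(delta_mx 0 k) g \o f) x 0 j)).
  apply: Cm_on_sum => // k; apply: Cm_onM => //.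
    exact: (Cm_on_coordP m ('D_v f) oA).1 (Df v) k.
  apply: (Cm_on_coordP m ('D_(delta_mx 0 k) g \o f) oA).1 _ j.
  exact: IHm (Cm_onW fC) (Dg _).
apply: Cm_on_congr => // x /set_mem Ax.
have dgx := dg _ (fAB _ Ax).
rewrite derive_comp_row //; last exact: df.
rewrite (deriveE _ dgx) [in RHS](row_sum_delta ('D_v f x)) linear_sum summxE.
by apply: eq_bigr => k _; rewrite linearZ mxE /= (deriveE _ dgx).
Qed.

End Cm.

(** * Derivatives of matrices and determinants; positive definite matrices *)

Lemma is_derive_mxP (R : realType) (V : normedModType R) m n
    (M : V -> 'M[R]_(m, n)) (dM : 'M[R]_(m, n)) (t v : V) :
  is_derive t v M dM <-> forall i j, is_derive t v (fun s => M s i j) (dM i j).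
Proof.
split=> [[dMt <-] i j|MD].
  rewrite derive_mx // mxE; apply: derivableP; by have /derivable_mxP := dMt.
have dMt : derivable M t v by apply/derivable_mxP => i j; have [] := MD i j.
split=> //; rewrite derive_mx //; apply/matrixP => i j; rewrite mxE.
by have [] := MD i j.
Qed.

Lemma is_derive_mulmx (R : realType) m n l (w : 'M[R]_(l, m))
    (M : R -> 'M[R]_(m, n)) (dM : 'M[R]_(m, n)) (t : R) :
  is_derive t 1 M dM -> is_derive t 1 (fun s => w *m M s) (w *m dM).
Proof.
move=> /is_derive_mxP MD; apply/is_derive_mxP => i j; rewrite mxE.
under eq_fun do rewrite mxE.
have := is_derive_sum (fun k => is_deriveZ (w i k) (MD k j)).
by rewrite fct_sumE.
Qed.

Section Determinant.
Variable R : realType.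

(** Uniqueness of the entries of [r] makes the condition [j != i] remove exactly one factor. *)
Lemma is_derive_prod (I : eqType) (r : seq I) (f : I -> R -> R) (df : I -> R)
    (t : R) : uniq r -> (forall i, is_derive t 1 (f i) (df i)) ->
  is_derive t 1 (fun s => \prod_(i <- r) f i s)
    (\sum_(i <- r) df i * \prod_(j <- r | j != i) f j t).
Proof.
move=> + fD; elim: r => [_|a r IHr /= /andP[ar ur]].
  rewrite big_nil; under eq_fun do rewrite big_nil.
  exact: is_derive_cst.
under eq_fun do rewrite big_cons.
apply: (is_derive_eq (is_deriveM (fD a) (IHr ur))).
rewrite !big_cons eqxx /= addrC; congr (_ + _).
  rewrite /GRing.scale /= mulrC; congr (_ * _).
  rewrite big_seq [RHS]big_seq_cond; apply: eq_bigl => i.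
  by case: (boolP (i \in r)) => //= ir; case: eqP ar ir => // -> /negP.
rewrite /GRing.scale /= big_distrr /= big_seq [RHS]big_seq.
apply: eq_bigr => i ir; rewrite big_cons.
have -> : a != i by case: eqP ar ir => // -> /negP.
by rewrite mulrCA.
Qed.

(** Jacobi's formula: differentiating the expansion over permutations replaces one row at a time by
    its derivative. *)
Lemma is_derive_det n (A : R -> 'M[R]_n) (dA : 'M[R]_n) (t : R) :
  is_derive t 1 A dA ->
  is_derive t 1 (fun s => \det (A s)) (\tr (dA *m \adj (A t))).
Proof.
move=> AD.
have AijD i j : is_derive t 1 (fun s => A s i j) (dA i j).
  by move/is_derive_mxP: AD; apply.
rewrite /determinant.
have -> : \tr (dA *m \adj (A t)) = \sum_(s : 'S_n) (-1) ^+ s *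
    \sum_i dA i (s i) * \prod_(j | j != i) A t j (s j).
  have Erow i : (dA *m \adj (A t)) i i =
      \sum_(s : 'S_n) (-1) ^+ s * (dA i (s i) * \prod_(j | j != i) A t j (s j)).
    (* Replacing row [i] of [A t] by row [i] of [dA] leaves the cofactors along that row unchanged,
       so expansion along it gives the diagonal entry. *)
    have <- : \det (\matrix_(k, j) if k == i then dA k j else A t k j) =
       (dA *m \adj (A t)) i i.
      rewrite (expand_det_row _ i) mxE; apply: eq_bigr => j _.
      rewrite !mxE eqxx /cofactor; congr (_ * (_ * \det _)).
      by apply/matrixP => k l; rewrite !mxE eq_sym (negbTE (neq_lift _ _)).
    apply: eq_bigr => s _; congr (_ * _).
    rewrite (bigD1 i) //= mxE eqxx; congr (_ * _).
    by apply: eq_bigr => j /negbTE ji; rewrite mxE ji.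
  rewrite /mxtrace (eq_bigr _ (fun i _ => Erow i)) exchange_big /=.
  by apply: eq_bigr => s _; rewrite mulr_sumr.
have prodD (s : 'S_n) : is_derive t 1 (fun x => (-1) ^+ s * \prod_i A x i (s i))
    ((-1) ^+ s * \sum_i dA i (s i) * \prod_(j | j != i) A t j (s j)).
  have := is_derive_prod (index_enum_uniq _) (fun i => AijD i (s i)).
  by move=> /(is_deriveZ ((-1) ^+ s)).
elim: (index_enum _) => [|s r IHr].
  rewrite big_nil; under eq_fun do rewrite big_nil.
  exact: is_derive_cst.
rewrite big_cons; under eq_fun do rewrite big_cons.
exact: is_deriveD.
Qed.

Lemma is_derive_sqrt_det n (A : R -> 'M[R]_n) (dA : 'M[R]_n) (t : R) :
  0 < \det (A t) -> is_derive t 1 A dA ->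
  is_derive t 1 (fun s => Num.sqrt (\det (A s)))
    (2^-1 * \tr (dA *m invmx (A t)) * Num.sqrt (\det (A t))).
Proof.
move=> detA_gt0 AD.
have detD := is_derive_det AD.
have [dd dE] := detD.
have [ds sE] := is_derive1_sqrt detA_gt0.
have /derivable1_diffP dfd := dd.
have /derivable1_diffP dfs := ds.
split; first exact/derivable1_diffP/(differentiable_comp dfd dfs).
rewrite -derive1E (derive1_comp dd ds) !derive1E sE dE.
have Au : A t \in unitmx by rewrite unitmxE unitfE gt_eqF.
rewrite /invmx Au -scalemxAr mxtraceZ.
set T := \tr _; set d := \det _ in detA_gt0 *.
have s0 : Num.sqrt d != 0 by rewrite gt_eqF // sqrtr_gt0.
(* Writing one [d] as the square of its root leaves a rational identity in that root. *)
rewrite -{2}(sqr_sqrtr (ltW detA_gt0)); field.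
by rewrite s0.
Qed.

(* The Schur complement of the corner entry is again positive definite. *)
Lemma det_gt0_posdef n (M : 'M[R]_n) :
  (forall x : 'rV[R]_n, x != 0 -> 0 < (x *m M *m x^T) 0 0) -> 0 < \det M.
Proof.
elim: n M => [|n IHn] M Mpos; first by rewrite det_mx00.
pose M' : 'M[R]_(1 + n) := M.
pose a := M 0 0; pose b := ursubmx M'.
pose c := dlsubmx M'; pose D := drsubmx M'.
have ME : M' = block_mx a%:M b c D.
  rewrite -[LHS]submxK; congr block_mx.
  by rewrite [LHS]mx11_scalar !mxE; congr (M _ _)%:M; apply/val_inj.
have a_gt0 : 0 < a.
  have := Mpos (delta_mx 0 0); rewrite -rowE trmx_delta -colE !mxE.
  apply; apply/eqP => /rowP/(_ 0); rewrite !mxE eqxx => /eqP.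
  by rewrite oner_eq0.
have a_neq0 : a != 0 by rewrite gt_eqF.
pose C := D - c *m (a^-1 *: b).
have MF : M' = block_mx 1%:M 0 (a^-1 *: c) 1%:M *m block_mx a%:M b 0 C.
  rewrite mulmx_block ME !mul1mx !mul0mx !addr0.
  rewrite mul_mx_scalar scalerA divff // scale1r.
  by congr block_mx; rewrite /C -scalemxAl -scalemxAr addrC subrK.
have -> : \det M = a * \det C.
  rewrite -[LHS]/(\det M') MF det_mulmx det_lblock det_ublock !det1 !mul1r.
  by rewrite det_scalar1.
rewrite mulr_gt0 //; apply: IHn => y y0.
(* The first block is chosen so that the lower triangular factor sends [x] to [row_mx 0 y]; the form
   of [M] at [x] is then that of [C] at [y]. *)
pose x : 'rV[R]_(1 + n) := row_mx (- (y *m (a^-1 *: c))) y.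
have x0 : x != 0.
  apply: contraNneq y0 => /(congr1 rsubmx); rewrite row_mxKr => ->.
  by rewrite linear0.
have : 0 < (x *m M' *m x^T) 0 0 by exact: Mpos.
rewrite MF mulmxA.
have -> : x *m block_mx 1%:M 0 (a^-1 *: c) 1%:M = row_mx 0 y.
  by rewrite mul_row_block !mulmx1 mulmx0 add0r addNr.
rewrite mul_row_block !mul0mx mulmx0 addr0 add0r tr_row_mx mul_row_col mul0mx.
by rewrite add0r.
Qed.

End Determinant.

(** * Charts, components of tangent vectors, smooth fields *)

Section Charts.
Variables (R : realType) (n : nat) (S : smooth_manifold R n).
Implicit Types (i j l : chart_index S) (p : S) (U : set S) (w : 'rV[R]_n).

Lemma psiK i y : (phi i @` dom i) y -> phi i (psi i y) = y.
Proof. by case=> p ip <-; rewrite phiK. Qed.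

Lemma dom_psi i y : (phi i @` dom i) y -> dom i (psi i y).
Proof. by case=> p ip <-; rewrite phiK. Qed.

Lemma near_cod i p : dom i p -> \forall y \near phi i p, (phi i @` dom i) y.
Proof.
by move=> ip; apply: open_nbhs_nbhs; split; [exact: cod_open|exists p].
Qed.

Lemma near_psi i p U : dom i p -> open U -> U p ->
  \forall y \near phi i p, U (psi i y).
Proof.
move=> ip oU Up; apply: (psi_continuous ip).
by rewrite phiK //; exact: open_nbhs_nbhs.
Qed.

Lemma chart_image_open i U : open U -> open (phi i @` (U `&` dom i)).
Proof.
move=> oU; rewrite openE => _ [p [Up ip] <-].
apply: filterS2 (near_cod ip) (near_psi ip oU Up) => y yi Uy.
by exists (psi i y); [split => //; exact: dom_psi|exact: psiK].
Qed.

Lemma transition_differentiable i j p : dom i p -> dom j p ->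
  differentiable (phi j \o psi i) (phi i p).
Proof.
by move=> ip jp; have [+ _] := chart_compat i j 1; apply; exists p.
Qed.

(** The cocycle identity for the derivatives of transition maps, by the chain rule: near [phi i p]
    the maps [psi j] and [phi j] in the middle cancel. *)
Lemma transition_comp i j l p w : dom i p -> dom j p -> dom l p ->
  'D_('D_w (phi j \o psi i) (phi i p)) (phi l \o psi j) (phi j p) =
  'D_w (phi l \o psi i) (phi i p).
Proof.
move=> ip jp lp.
have fE : (phi j \o psi i) (phi i p) = phi j p by rewrite /= phiK.
rewrite -[in LHS]fE -derive_comp_row; last 2 first.
- exact: transition_differentiable.
- by rewrite fE; exact: transition_differentiable.
apply: near_eq_derive; apply: filterS (near_psi ip (dom_open j) jp) => y jy /=.
by rewrite phiK.
Qed.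

Lemma transition_id i p w : dom i p -> 'D_w (phi i \o psi i) (phi i p) = w.
Proof.
move=> ip; rewrite -[RHS](derive_id (phi i p) w).
by apply: near_eq_derive; apply: filterS (near_cod ip) => y; exact: psiK.
Qed.

Lemma tcoord_tvec i j p w : dom i p -> dom j p ->
  tcoord j (tvec i p w) = 'D_w (phi j \o psi i) (phi i p).
Proof. by move=> ip jp; apply: transition_comp => //; exact: dom_pref. Qed.

Lemma tvecK i p w : dom i p -> tcoord i (tvec i p w) = w.
Proof. by move=> ip; rewrite tcoord_tvec // transition_id. Qed.

Lemma tvecE i p w : dom i p ->
  tvec i p w = w *m jacobian (phi (pref p) \o psi i) (phi i p).
Proof.
move=> ip; apply/deriveEjacobian/transition_differentiable => //.
exact: dom_pref.
Qed.

Lemma tcoordE i p (v : tangent p) : dom i p ->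
  tcoord i v = v *m jacobian (phi i \o psi (pref p)) (phi (pref p) p).
Proof.
move=> ip; apply/deriveEjacobian/transition_differentiable => //.
exact: dom_pref.
Qed.

Lemma tvec_linear i p : dom i p ->
  linear (tvec i p : 'rV[R]_n -> tangent p).
Proof.
move=> ip a u w; rewrite !tvecE // mulmxDl.
by congr (_ + _); rewrite -scalemxAl.
Qed.

(** A tangent vector at [p] is stored by its components in [pref p], so in that chart the
    conversions are identities. Computations at time [t] in the chart of [gamma t] rely on this. *)
Lemma tvec_pref p w : tvec (pref p) p w = w.
Proof. exact/transition_id/dom_pref. Qed.

Lemma tcoord_pref p (v : tangent p) : tcoord (pref p) v = v.
Proof. exact/transition_id/dom_pref. Qed.

Lemma smooth_map_congr (W : normedModType R) U (f g : S -> W) : open U ->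
  {in U, f =1 g} -> smooth_map U f -> smooth_map U g.
Proof.
move=> oU fg fU i m; apply: Cm_on_congr (fU i m); first exact: chart_image_open.
by move=> _ /set_mem[p [Up ip] <-]; rewrite /= phiK // fg //; exact/mem_set.
Qed.

Lemma smooth_field_congr U (X Y : vector_field S) : open U ->
  {in U, forall p, X p = Y p} -> smooth_field U X -> smooth_field U Y.
Proof.
move=> oU XY XU i; apply: smooth_map_congr (XU i).
  by apply: openI => //; exact: dom_open.
by move=> p /set_mem[Up _]; rewrite XY //; exact/mem_set.
Qed.

(** In another chart the components are directional derivatives of a transition map; its class
    C^(m+1) pays for the derivative, and a second transition map moves the base point to the chart
    [l]. *)
Lemma smooth_coord_field i w : smooth_field (dom i) (fun p => tvec i p w).
Proof.
move=> j; pose f p := 'D_w (phi j \o psi i) (phi i p).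
apply: (@smooth_map_congr _ _ f); first by apply: openI; exact: dom_open.
  by move=> p /set_mem[ip jp]; rewrite tcoord_tvec.
move=> l m; set A := phi l @` _.
have oA : open A by apply: chart_image_open; apply: openI; exact: dom_open.
have [_ Dm] := chart_compat i j m.+1.
apply: (Cm_on_comp oA _ _ _ (Dm w)).
- by rewrite setIC; apply: chart_image_open; exact: dom_open.
- by move=> _ [p [[ip jp] lp] <-]; rewrite /= phiK //; exists p.
- apply: Cm_on_subset (chart_compat l i m).
  by move=> _ [p [[ip jp] lp] <-]; exists p.
Qed.

(** Chain rule for [f \o psi i] after [phi i \o gamma]; by continuity [gamma] stays in [dom i] near
    [t], where this composite is [f \o gamma]. *)
Lemma derive1_smooth_map (W : normedModType R) i U (f : S -> W)
    (gamma : R -> S) (t : R) :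
  open U -> smooth_map U f -> U (gamma t) -> dom i (gamma t) ->
  {for t, continuous gamma} -> differentiable (phi i \o gamma) t ->
  is_derive t 1 (f \o gamma)
    ('D_(derive1 (phi i \o gamma) t) (f \o psi i) (phi i (gamma t))).
Proof.
move=> oU fU Ut it gc gd.
have fd : differentiable (f \o psi i) ((phi i \o gamma) t).
  by have [+ _] := fU i 1%N; apply; exists (gamma t).
have near_gamma : \near t, (f \o psi i \o (phi i \o gamma)) t = (f \o gamma) t.
  have : \forall s \near t, dom i (gamma s).
    by apply: gc; apply: open_nbhs_nbhs; split => //; exact: dom_open.
  by apply: filterS => s is_ /=; rewrite phiK.
apply: (near_eq_is_derive near_gamma); split.
  exact/diff_derivable/differentiable_comp.
rewrite derive1E deriveE; last exact: differentiable_comp.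
by rewrite diff_comp //= -deriveE // -deriveE.
Qed.

End Charts.

(** * Fibrewise inner products and Gram matrices *)

Section InnerProduct.
Variables (R : realType) (n : nat) (S : smooth_manifold R n).
Variables (E : S -> lmodType R) (g : forall p, E p -> E p -> R).
Arguments g {p}.
Hypothesis g_ip : fibrewise_inner_product (@g).

Lemma inner_productDl p a (x y z : E p) : g (a *: x + y) z = a * g x z + g y z.
Proof. by case: g_ip. Qed.

Lemma inner_productC p (x y : E p) : g x y = g y x.
Proof. by case: g_ip. Qed.

Lemma inner_product_suml p (I : Type) (r : seq I) (a : I -> R)
    (f : I -> E p) z :
  g (\sum_(i <- r) a i *: f i) z = \sum_(i <- r) a i * g (f i) z.
Proof.
elim: r => [|i r IHr].
  rewrite !big_nil; have := inner_productDl 1 0 0 z.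
  rewrite scale1r addr0 mul1r => /eqP.
  by rewrite -subr_eq0 opprD addNKr oppr_eq0 => /eqP.
by rewrite !big_cons inner_productDl IHr.
Qed.

(** The family [E] is arbitrary because Gram matrices are taken both in the tangent spaces and in
    the response bundle. *)
Definition gram_mx p m (f : 'I_m -> E p) : 'M[R]_m :=
  \matrix_(k, l) g (f k) (f l).

Lemma gram_mx_mul p m m' (V : 'M[R]_(m', m)) (f : 'I_m -> E p) :
  gram_mx (fun k => \sum_l V k l *: f l) = V *m gram_mx f *m V^T.
Proof.
apply/matrixP => k l; rewrite -mulmxA !mxE inner_product_suml.
apply: eq_bigr => a _; congr (_ * _).
rewrite mxE inner_productC inner_product_suml.
by apply: eq_bigr => b _; rewrite !mxE mulrC inner_productC.
Qed.

(** The quadratic form of the Gram matrix at [x] is the squared norm of the combination of the [f k]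
    with coefficients [x], which independence makes positive. *)
Lemma gram_mx_det_gt0 p m (f : 'I_m -> E p) :
  (forall x : 'rV[R]_m, x != 0 -> \sum_k x 0 k *: f k != 0) ->
  0 < \det (gram_mx f).
Proof.
move=> f_free; apply: det_gt0_posdef => x /f_free xf0.
by rewrite -gram_mx_mul mxE; case: g_ip => _ _; apply.
Qed.

End InnerProduct.

(** * Locality and linearity of a connection on coordinate fields *)

Section Connection.
Variables (R : realType) (n : nat) (S : smooth_manifold R n).
Variable nabla : vector_field S -> forall p : S, tangent p -> tangent p.
Hypothesis nabla_conn : is_connection nabla.

Lemma differential_near_cst (f : S -> R) (U : set S) c p (v : tangent p) :
  open U -> U p -> (forall q, U q -> f q = c) -> differential f v = 0.
Proof.
move=> oU Up fc; rewrite /differential -(derive_cst c (phi (pref p) p) v).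
apply: near_eq_derive.
by apply: filterS (near_psi (dom_pref p) oU Up) => y /fc.
Qed.

(* nabla is extended from local sections to arbitrary ones without any
   locality axiom; the Leibniz rule for the indicator function of U, which is
   smooth on U, supplies it. *)
Lemma connection_local (U : set S) X Y p (v : tangent p) : open U -> U p ->
  smooth_field U X -> smooth_field U Y -> (forall q, U q -> X q = Y q) ->
  nabla X v = nabla Y v.
Proof.
move=> oU Up XU YU XY; have [_ _ leibniz _] := nabla_conn.
pose f q : R := (q \in U)%:R.
have fU : smooth_map U f.
  have U1 : smooth_map U (fun=> 1 : R) by move=> i m; exact: Cm_on_cst.
  by apply: smooth_map_congr U1 => // q qU; rewrite /f qU.
have nablaf Z : smooth_field U Z -> nabla (fun q => f q *: Z q) v = nabla Z v.
  move=> ZU; rewrite (leibniz U) // (@differential_near_cst f U 1) //.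
    by rewrite /f mem_set // scale0r add0r scale1r.
  by move=> q Uq; rewrite /f mem_set.
(* Once multiplied by the indicator, the two fields agree on all of [S] and are therefore equal. *)
rewrite -(nablaf X) // -(nablaf Y) //; congr (nabla _ _).
apply: functional_extensionality_dep => q; rewrite /f.
by case: (boolP (q \in U)) => [/set_mem/XY->|]; rewrite ?scale0r.
Qed.

(** The coordinate field of [a *: u + w] is the combination of the other two only on [dom i], hence
    the use of locality; scalars come out by the Leibniz rule for a constant function. *)
Lemma connection_coord_linear i p (v : tangent p) : dom i p ->
  linear (fun w => nabla (fun q => tvec i q w) v : tangent p).
Proof.
move=> ip a u w /=; have [_ add leibniz _] := nabla_conn.
have oi := dom_open i.
have su := smooth_coord_field i u; have sw := smooth_coord_field i w.
have sau : smooth_field (dom i) (fun q => a *: tvec i q u).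
  apply: smooth_field_congr (smooth_coord_field i (a *: u)) => // q /set_mem iq.
  by rewrite !tvecE // scalemxAl.
have sauw : smooth_field (dom i) (fun q => a *: tvec i q u + tvec i q w).
  apply: smooth_field_congr (smooth_coord_field i (a *: u + w)) => // q.
  by move/set_mem => iq; exact: tvec_linear.
rewrite (connection_local _ oi ip _ sauw); last 2 first.
- exact: smooth_coord_field.
- by move=> q iq; exact: tvec_linear.
rewrite (add (dom i)) // (leibniz (dom i) (fun=> a)) //; last first.
  by move=> j m; exact: Cm_on_cst.
by rewrite (@differential_near_cst _ (dom i) a) // scale0r add0r.
Qed.

End Connection.

(** * Coordinate matrices of endomorphisms and of the metric *)

Lemma endo_mx_mul (R : realType) (n : nat) (S : smooth_manifold R n) (p : S)
    (B : 'M[R]_n) : endo_mx (fun w : tangent p => (w : 'rV[R]_n) *m B) = B.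
Proof. by apply/matrixP => k l; rewrite mxE -rowE mxE. Qed.

Section CoordinateMatrices.
Variables (R : realType) (n : nat) (S : smooth_manifold R n).
Variable G : forall p : S, {linear tangent p -> tangent p}.

(** Rows are the images of the coordinate vectors, so matrices act on row vectors from the right and
    composition reverses the order of products. *)
Definition coord_endo_mx (i : chart_index S) (p : S) : 'M[R]_n :=
  \matrix_k (tcoord i (G p (tvec i p (delta_mx 0 k))) : 'rV[R]_n).

Lemma endo_mxE (p : S) (w : 'rV[R]_n) :
  (G p w : 'rV[R]_n) = w *m endo_mx (G p).
Proof.
pose G' : {linear 'rV[R]_n -> 'rV[R]_n} := G p.
by rewrite -[endo_mx _]/(lin1_mx G') mul_rV_lin1.
Qed.

Lemma coord_endo_mxE i p : dom i p -> coord_endo_mx i p =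
  jacobian (phi (pref p) \o psi i) (phi i p) *m endo_mx (G p) *m
  jacobian (phi i \o psi (pref p)) (phi (pref p) p).
Proof.
move=> ip; apply/row_matrixP => k; rewrite rowK tcoordE // tvecE //.
by rewrite endo_mxE rowE !mulmxA.
Qed.

Lemma mul_coord_endo_mx i p (w : 'rV[R]_n) : dom i p ->
  w *m coord_endo_mx i p = tcoord i (G p (tvec i p w)).
Proof.
by move=> ip; rewrite coord_endo_mxE // tcoordE // tvecE // endo_mxE !mulmxA.
Qed.

Lemma coord_endo_mx_pref p : coord_endo_mx (pref p) p = endo_mx (G p).
Proof.
by apply/row_matrixP => k; rewrite rowK tvec_pref tcoord_pref endo_mxE rowE.
Qed.

(** The two Jacobians flanking [endo_mx (G p)] are mutually inverse, so the matrices are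
    conjugate. *)
Lemma det_coord_endo_mx i p : dom i p ->
  \det (coord_endo_mx i p) = endo_det (G p).
Proof.
move=> ip; rewrite coord_endo_mxE // !det_mulmx mulrAC -det_mulmx.
suff -> : jacobian (phi (pref p) \o psi i) (phi i p) *m
  jacobian (phi i \o psi (pref p)) (phi (pref p) p) = 1%:M
  by rewrite det1 mul1r.
apply/row_matrixP => k; rewrite !rowE mulmxA mulmx1 -tvecE // -tcoordE //.
exact: tvecK.
Qed.

End CoordinateMatrices.

Section CoordinateGram.
Variables (R : realType) (n : nat) (S : smooth_manifold R n).
Variable gS : forall p : S, tangent p -> tangent p -> R.
Hypothesis gS_ip : fibrewise_inner_product gS.

Definition coord_gram_mx (i : chart_index S) (p : S) : 'M[R]_n :=
  gram_mx gS (fun k => tvec i p (delta_mx 0 k)).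

Lemma inner_product_row p (a : 'rV[R]_n) (y : tangent p) :
  gS (a : tangent p) y = \sum_k a 0 k * gS (delta_mx 0 k : tangent p) y.
Proof.
rewrite {1}(row_sum_delta a).
exact: (inner_product_suml gS_ip _ _ (fun k => delta_mx 0 k : tangent p)).
Qed.

Lemma det_coord_gram_mx_gt0 p : 0 < \det (coord_gram_mx (pref p) p).
Proof.
apply: gram_mx_det_gt0 => // x; apply: contraNneq => x0; apply/eqP.
rewrite [LHS]row_sum_delta -[RHS]x0.
by apply: eq_bigr => k _; rewrite tvec_pref.
Qed.

(** Separates the components [w], which enter as a constant factor, from the base point, so that
    along a path only two determinants vary. *)
Lemma response_volume_tvec (G : forall p : S, {linear tangent p -> tangent p})
    i p (w : 'I_n -> 'rV[R]_n) : dom i p ->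
  response_volume gS G (fun k => tvec i p (w k)) =
  `|\det (\matrix_k w k)| * (Num.sqrt (\det (coord_endo_mx G i p)) *
     Num.sqrt (\det (coord_gram_mx i p))).
Proof.
move=> ip; rewrite /response_volume det_coord_endo_mx // mulrCA; congr (_ * _).
set V := \matrix_k w k.
have -> : riemannian_volume gS (fun k => tvec i p (w k)) =
    Num.sqrt (\det (V *m coord_gram_mx i p *m V^T)).
  rewrite /coord_gram_mx -(gram_mx_mul gS_ip); congr (Num.sqrt (\det _)).
  apply/matrixP => k l; rewrite !mxE.
  have tvec_row a : tvec i p (w a) = \sum_b V a b *: tvec i p (delta_mx 0 b).
    rewrite tvecE // [w a]row_sum_delta mulmx_suml; apply: eq_bigr => b _.
    by rewrite tvecE // -scalemxAl mxE.
  by rewrite !tvec_row.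
rewrite !det_mulmx det_tr mulrAC -expr2 sqrtrM ?sqr_ge0 //.
by rewrite sqrtr_sqr.
Qed.

(** The matrix of [G p] times the Gram matrix of the coordinate basis is the [h]-Gram matrix of the
    images under [f]. Injectivity keeps these images independent, so the product has positive
    determinant, and so has its second factor. *)
Lemma endo_det_gram_gt0 (E : S -> lmodType R)
    (h : forall p : S, E p -> E p -> R)
    (G : forall p : S, {linear tangent p -> tangent p})
    (f : forall p : S, {linear tangent p -> E p}) p :
  fibrewise_inner_product h ->
  (forall X Y : tangent p, gS (G p X) Y = h p (f p X) (f p Y)) ->
  (forall X : tangent p, f p X = 0 -> X = 0) ->
  0 < endo_det (G p).
Proof.
move=> h_ip Gh f_inj; rewrite -(pmulr_lgt0 _ (det_coord_gram_mx_gt0 p)).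
rewrite /endo_det -det_mulmx.
have -> : endo_mx (G p) *m coord_gram_mx (pref p) p =
    gram_mx h (fun k => f p (delta_mx 0 k : tangent p)).
  apply/matrixP => k l; rewrite !mxE -Gh endo_mxE -rowE inner_product_row.
  by apply: eq_bigr => j _; rewrite !mxE !tvec_pref.
apply: gram_mx_det_gt0 => // x; apply: contraNneq => fx0.
have fxE : f p (\sum_k x 0 k *: (delta_mx 0 k : tangent p)) = 0.
  by rewrite linear_sum -[RHS]fx0; apply: eq_bigr => k _; exact: linearZ.
by apply/eqP; rewrite -(f_inj _ fxE); exact: row_sum_delta.
Qed.

End CoordinateGram.

(** * Covariant derivatives along a path in the chart around [gamma t] *)

Section AlongPath.
Variables (R : realType) (n : nat) (S : smooth_manifold R n).
Variable nabla : vector_field S -> forall p : S, tangent p -> tangent p.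
Hypothesis nabla_conn : is_connection nabla.
Variables (gamma : R -> S) (t : R).
Hypothesis gamma_cont : {for t, continuous gamma}.
Hypothesis gamma_diff : forall i,
  dom i (gamma t) -> differentiable (phi i \o gamma) t.
Let i := pref (gamma t).
Let it : dom i (gamma t) := dom_pref (gamma t).

Lemma near_path_dom : \forall s \near t, dom i (gamma s).
Proof.
by apply: gamma_cont; apply: open_nbhs_nbhs; split=> //; exact: dom_open.
Qed.

(** The Christoffel symbols contracted with the velocity. *)
Definition connection_mx : 'M[R]_n :=
  lin1_mx (fun w : 'rV[R]_n =>
    nabla (fun q => tvec i q w) (velocity gamma t) : 'rV[R]_n).

Lemma mul_connection_mx (w : 'rV[R]_n) :
  w *m connection_mx = nabla (fun q => tvec i q w) (velocity gamma t).
Proof.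
pose f := fun w : 'rV[R]_n =>
  nabla (fun q => tvec i q w) (velocity gamma t) : 'rV[R]_n.
have f_lin : linear f by exact: connection_coord_linear.
pose fL := GRing.isLinear.Build _ _ _ _ f f_lin.
pose F : {linear 'rV[R]_n -> 'rV[R]_n} := HB.pack f fL.
by rewrite -[connection_mx]/(lin1_mx F) mul_rV_lin1.
Qed.

Lemma extend_id (w : tangent (gamma t)) : extend w t = w.
Proof. exact: tvec_pref. Qed.

(** The components in the chart are constant near [t], so only the connection term survives. *)
Lemma Ddt_extend (w : tangent (gamma t)) :
  Ddt_vector nabla (extend w) t = (w : 'rV[R]_n) *m connection_mx.
Proof.
rewrite /Ddt_vector extend_id mul_connection_mx -[RHS]add0r; congr (_ + _).
rewrite derive1E -(derive_cst (w : 'rV[R]_n) t 1).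
by apply: near_eq_derive; apply: filterS near_path_dom => s; exact: tvecK.
Qed.

Variable G : forall p : S, {linear tangent p -> tangent p}.
Hypothesis G_smooth : smooth_endomorphism G.

Lemma is_derive_coord_endo_mx :
  is_derive t 1 (coord_endo_mx G i \o gamma)
    ('D_1 (coord_endo_mx G i \o gamma) t).
Proof.
apply: derivableP; apply/derivable_mxP => k l.
(* [smooth_field] tests the field on [dom i] in a second chart, here again [i]; hence the
   intersection of [dom i] with itself. *)
have [dG _] := derive1_smooth_map (openI (dom_open i) (dom_open i))
  (G_smooth i (delta_mx 0 k) i) (conj it it) it gamma_cont (gamma_diff it).
move/derivable_mxP: dG => /(_ 0 l).
by under [X in _ -> derivable X _ _]eq_fun do rewrite /= mxE.
Qed.

(** Differentiating the image of a frame vector gives [A'] and, from the connection, [M C];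
    subtracting the image of its covariant derivative gives [C M], in the row convention. *)
Lemma Ddt_endoE (w : tangent (gamma t)) :
  Ddt_endo nabla (fun s => G (gamma s)) w = (w : 'rV[R]_n) *m
    ('D_1 (coord_endo_mx G i \o gamma) t +
     endo_mx (G (gamma t)) *m connection_mx -
     connection_mx *m endo_mx (G (gamma t))).
Proof.
rewrite /Ddt_endo Ddt_extend endo_mxE mulmxBr mulmxDr !mulmxA; congr (_ - _).
rewrite /Ddt_vector extend_id -endo_mxE mul_connection_mx; congr (_ + _).
rewrite derive1E.
have [_ <-] := is_derive_mulmx (w : 'rV[R]_n) is_derive_coord_endo_mx.
apply: near_eq_derive; apply: filterS near_path_dom => s si.
by rewrite /= mul_coord_endo_mx.
Qed.

(** After multiplication by the inverse of [M], the connection terms are a conjugate of [C] and [C]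
    itself, with equal traces. *)
Lemma tr_Ddt_endo : endo_mx (G (gamma t)) \in unitmx ->
  endo_tr (fun w : tangent (gamma t) => endo_inv (G (gamma t))
     (Ddt_endo nabla (fun s => G (gamma s)) w)) =
  \tr ('D_1 (coord_endo_mx G i \o gamma) t *m invmx (endo_mx (G (gamma t)))).
Proof.
move=> Gu; rewrite /endo_tr; set M := endo_mx (G (gamma t)) in Gu *.
set dA := 'D_1 _ t; set C := connection_mx.
have -> : (fun w : tangent (gamma t) => endo_inv (G (gamma t))
     (Ddt_endo nabla (fun s => G (gamma s)) w)) =
    (fun w : tangent (gamma t) =>
       (w : 'rV[R]_n) *m ((dA + M *m C - C *m M) *m invmx M)).
  by apply/funext => w; rewrite /endo_inv Ddt_endoE mulmxA.
rewrite endo_mx_mul mulmxBl mulmxDl linearB linearD /= mulmxK // -mulmxA.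
rewrite [\tr (M *m _)]mxtrace_mulC.
by rewrite mulmxKV // addrK.
Qed.

Variable gS : forall p : S, tangent p -> tangent p -> R.
Hypothesis gS_metric : riemannian_metric gS.
Hypothesis nabla_metric : metric_compatible gS nabla.

(** Metric compatibility applied to pairs of coordinate fields, their covariant derivatives being
    expanded in the coordinate basis. *)
Lemma is_derive_coord_gram_mx : is_derive t 1 (coord_gram_mx gS i \o gamma)
  (connection_mx *m coord_gram_mx gS i (gamma t) +
   coord_gram_mx gS i (gamma t) *m connection_mx^T).
Proof.
have [gS_ip gS_smooth] := gS_metric.
apply/is_derive_mxP => k l.
have := derive1_smooth_map (dom_open i)
  (gS_smooth i (delta_mx 0 k) (delta_mx 0 l)) it it gamma_cont (gamma_diff it).
under [X in _ -> is_derive _ _ X _]eq_fun do rewrite /= mxE.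
move=> /is_derive_eq; apply.
have := nabla_metric (velocity gamma t) (dom_open i) it
  (smooth_coord_field i (delta_mx 0 k)) (smooth_coord_field i (delta_mx 0 l)).
(* [differential] and [velocity] both use the preferred chart, so the value given by the chain rule
   is the left side of metric compatibility. *)
rewrite /differential -/i => ->.
rewrite -!mul_connection_mx -!rowE mxE; congr (_ + _).
  rewrite (inner_product_row gS_ip) mxE; apply: eq_bigr => j _.
  by rewrite [row _ _ _ _]mxE [coord_gram_mx _ _ _ _ _]mxE !tvec_pref.
rewrite (inner_productC gS_ip) (inner_product_row gS_ip) mxE.
apply: eq_bigr => j _.
rewrite [row _ _ _ _]mxE [coord_gram_mx _ _ _ _ _]mxE [_^T _ _]mxE mulrC.
by rewrite !tvec_pref (inner_productC gS_ip).
Qed.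

Hypothesis G_pos : 0 < endo_det (G (gamma t)).

Lemma Ddt_response_volume (v : 'I_n -> tangent (gamma t)) :
  Ddt_density nabla (fun s => @response_volume R n S gS G (gamma s)) v =
  2^-1 * endo_tr (fun w : tangent (gamma t) =>
           endo_inv (G (gamma t))
             (Ddt_endo nabla (fun s => G (gamma s)) w)) *
  response_volume gS G v.
Proof.
have [gS_ip _] := gS_metric.
set M := endo_mx (G (gamma t)); set q := coord_gram_mx gS i (gamma t).
set C := connection_mx; set dA := 'D_1 (coord_endo_mx G i \o gamma) t.
have MA : coord_endo_mx G i (gamma t) = M by exact: coord_endo_mx_pref.
have q_gt0 : 0 < \det q by exact: det_coord_gram_mx_gt0.
have Mu : M \in unitmx by rewrite unitmxE unitfE gt_eqF.
have qu : q \in unitmx by rewrite unitmxE unitfE gt_eqF.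
rewrite tr_Ddt_endo // -/M -/dA.
(* The frame has constant components, so this factor does not depend on the time. *)
pose rho := `|\det (\matrix_k (v k : 'rV[R]_n))|.
have vol_t : response_volume gS G v =
    rho * (Num.sqrt (\det M) * Num.sqrt (\det q)).
  rewrite -MA -(response_volume_tvec gS_ip G v it).
  by congr (response_volume _ _ _); apply/funext => k; rewrite tvec_pref.
have AD := is_derive_coord_endo_mx; have qD := is_derive_coord_gram_mx.
have sA : is_derive t 1 (fun s => Num.sqrt (\det (coord_endo_mx G i (gamma s))))
    (2^-1 * \tr (dA *m invmx M) * Num.sqrt (\det M)).
  by have := is_derive_sqrt_det _ AD; rewrite /= MA; apply.
have sq : is_derive t 1
    (fun s => Num.sqrt (\det (coord_gram_mx gS i (gamma s))))
    (\tr C * Num.sqrt (\det q)).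
  have /= := is_derive_sqrt_det q_gt0 qD; move/is_derive_eq; apply.
  (* Both summands of [q'] contribute [\tr C], and the factor one half from the square root absorbs
     the doubling. *)
  congr (_ * _); rewrite mulmxDl mxtraceD mulmxK // mxtrace_mulC mulmxA.
  by rewrite mulVmx // mul1mx mxtrace_tr; field.
rewrite /Ddt_density.
have -> : endo_tr (fun w : tangent (gamma t) => Ddt_vector nabla (extend w) t) =
    \tr C.
  rewrite /endo_tr; congr (\tr _); rewrite -[RHS](endo_mx_mul (gamma t)).
  by congr endo_mx; apply/funext => w; exact: Ddt_extend.
have [_ volD] := is_deriveZ rho (is_deriveM sA sq).
have -> : derive1 (fun s =>
      response_volume gS G (fun k => extend (v k) s : tangent (gamma s))) t =
    rho * (2^-1 * \tr (dA *m invmx M) + \tr C) *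
      (Num.sqrt (\det M) * Num.sqrt (\det q)).
  rewrite derive1E; transitivity
   ('D_1 (rho *: ((fun s => Num.sqrt (\det (coord_endo_mx G i (gamma s)))) *
     (fun s => Num.sqrt (\det (coord_gram_mx gS i (gamma s)))))) t).
    (* The product formula for the volume holds while [gamma s] lies in the chart domain, hence near
       [t]. *)
    apply: near_eq_derive; apply: filterS near_path_dom => s si.
    exact: response_volume_tvec.
  rewrite volD /= MA -/q /GRing.scale /=; ring.
by rewrite vol_t; ring.
Qed.

End AlongPath.

Theorem corollary6p4 (R : realType) (n k : nat) (n_gt0 : (0 < n)%N)
    (S : smooth_manifold R n) (Z : vector_bundle S k)
    (hZ : forall p : S, Z p -> Z p -> R) (hZ_metric : fibre_metric hZ)
    (Rm : forall p : S, {linear tangent p -> Z p})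
    (Rm_smooth : smooth_morphism Rm)
    (gS : forall p : S, tangent p -> tangent p -> R)
    (gS_metric : riemannian_metric gS)
    (nabla : vector_field S -> forall p : S, tangent p -> tangent p)
    (nabla_LC : levi_civita gS nabla)
    (G : forall p : S, {linear tangent p -> tangent p})
    (G_smooth : smooth_endomorphism G)
    (G_gram : forall (p : S) (X Y : tangent p),
       gS p (G p X) Y = response_metric hZ Rm X Y)
    (J : set R) (J_interval : is_interval J)
    (gamma : R -> S) (gamma_smooth : smooth_path J gamma)
    (gamma_comp : forall t, J t -> complete_locus Rm (gamma t))
    (t : R) (Jt : J t) (v : 'I_n -> tangent (gamma t)) :
  Ddt_density nabla (fun s => @response_volume R n S gS G (gamma s)) v =
  2^-1 * endo_tr (fun w : tangent (gamma t) =>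
           endo_inv (G (gamma t))
             (Ddt_endo nabla (fun s => G (gamma s)) w)) *
  response_volume gS G v.
Proof.
have [nabla_conn _ nabla_metric] := nabla_LC.
have [hZ_ip _] := hZ_metric; have [gS_ip _] := gS_metric.
(* [N] is open and may reach beyond [J], so two-sided derivatives exist also at an endpoint of
   [J]. *)
have [N [oN Nt gamma_cont gamma_sm]] := gamma_smooth t Jt.
apply: Ddt_response_volume => //.
- exact: gamma_cont.
- by move=> i it; have [+ _] := gamma_sm i 1%N; apply.
- apply: (endo_det_gram_gt0 gS_ip hZ_ip (G_gram (gamma t))) => X RX0.
  (* Membership in [complete_locus] equates the kernel with [[set 0]], so rewriting by it turns
     kernel membership into [X = 0]. *)
  have : [set X | Rm (gamma t) X = 0] X by [].
  by rewrite (gamma_comp t Jt).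
Qed.
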